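(* There are only finitely many $3$-dicritical semi-complete digraphs (up to isomorphism).
   Context: Digraphs are finite, with no loops and no parallel arcs (a pair of opposite arcs $uv,vu$, called a digon, is allowed). A $k$-dicolouring of a digraph $D$ is a map $\phi:V(D)\to\{1,\dots,k\}$ such that each colour class induces an acyclic subdigraph (no directed cycle; a digon counts as a directed cycle of length 2). $D$ is $k$-dicolourable if it has a $k$-dicolouring. $D$ is $3$-dicritical if $D$ is not $2$-dicolourable but every proper subdigraph of $D$ (obtained by deleting at least one vertex or arc) is $2$-dicolourable. A digraph is semi-complete if for every two distinct vertices $u,v$ at least one of the arcs $uv$, $vu$ is present. *)

(* Defs.v *)
(* A digraph is a finite vertex type T with an arc relation
   A : rel T (so no parallel arcs; digons A u v && A v u allowed). *)
From mathcomp Require Import all_boot.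
Set Implicit Arguments. Unset Strict Implicit. Unset Printing Implicit Defensive.

Definition loopless (T : finType) (A : rel T) : Prop := forall x, ~~ A x x.

Definition semicomplete (T : finType) (A : rel T) : Prop :=
  forall u v : T, u != v -> A u v || A v u.

(* a directed cycle of A inside the vertex set S: a nonempty sequence of
   distinct vertices of S, x_0 -> x_1 -> ... -> x_{m-1} -> x_0
   (a digon is the case m = 2). *)
Definition has_dicycle_in (T : finType) (A : rel T) (S : pred T) : Prop :=
  exists s : seq T, [/\ 0 < size s, uniq s, all S s & cycle A s].

Definition acyclic_in (T : finType) (A : rel T) (S : pred T) : Prop :=
  ~ has_dicycle_in A S.

Definition dicolourable_on (T : finType) (S : {set T}) (B : rel T) (k : nat) : Prop :=
  exists phi : T -> 'I_k,
    forall c : 'I_k, acyclic_in B [pred x | (x \in S) && (phi x == c)].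

Definition dicolourable (T : finType) (A : rel T) (k : nat) : Prop :=
  dicolourable_on [set: T] A k.

Definition proper_subdigraph (T : finType) (A : rel T) (S : {set T}) (B : rel T) : Prop :=
  [/\ (forall x y, B x y -> [&& A x y, x \in S & y \in S])
    & (S != [set: T] \/ exists x y, [&& x \in S, y \in S, A x y & ~~ B x y])].

Definition dicritical3 (T : finType) (A : rel T) : Prop :=
  ~ dicolourable A 2 /\
  forall (S : {set T}) (B : rel T), proper_subdigraph A S B -> dicolourable_on S B 2.

Definition diso (T : finType) (A : rel T) (n : nat) (B : rel 'I_n) : Prop :=
  exists f : T -> 'I_n, bijective f /\ forall x y, A x y = B (f x) (f y).

(* Main.v *)
Require Import Defs.
From mathcomp Require Import all_boot.

(** If [uv] is an arc of a 3-dicritical semi-complete digraph [D], then [D - uv] has a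
    2-dicolouring, and since [D] has none, [u], [v] and some [w] with [v -> w -> u]
    (or just the digon [uv]) are monochromatic.  Semi-completeness then forces every
    [z] with [u -> z -> v] to have the other colour.

    In a huge [D], Ramsey's theorem gives a long induced transitive tournament.  Cut it
    into consecutive pairs [p -> q] and complete each pair to a directed triangle
    [p -> q -> w -> p].  A second use of Ramsey's theorem gives three triangles such that
    the arcs between two of them depend only on their order.  There are finitely many
    possibilities for these nine vertices, and a case analysis shows that each has an
    arc [uv] admitting no colouring as above; so the order of [D] is bounded. *)

Set Implicit Arguments. Unset Strict Implicit. Unset Printing Implicit Defensive.

(** * Ramsey's theorem for pairs *)

Lemma pigeonhole_count (X : Type) (C : finType) (g : X -> C) (m : nat) (s : seq X) :
  m * #|C| < size s -> exists c, m < count (fun x => g x == c) s.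
Proof.
move=> lt_ms; have [c hc|none] := pickP (fun c => m < count (fun x => g x == c) s).
  by exists c.
suff: size s <= m * #|C| by rewrite leqNgt lt_ms.
have -> : size s = \sum_(c : C) count (fun x => g x == c) s.
  elim: {lt_ms none} s => [|x s IHs] /=; first by rewrite big1.
  rewrite big_split /= -IHs (bigD1 (g x)) //= eqxx big1 ?addn0 // => c.
  by rewrite eq_sym => /negbTE ->.
rewrite mulnC -sum_nat_const; apply: leq_sum => c _.
by rewrite leqNgt none.
Qed.

(** Greedy choice: the head is kept, and the recursion continues inside a large colour class of its
    pairs with the tail. That colour is recorded next to the head. *)
Lemma ramsey_end_homogeneous (C : finType) (m : nat) :
  exists N, forall (X : eqType) (chi : X -> X -> C) (s : seq X), N <= size s ->
    exists t : seq (X * C),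
      [/\ size t = m, subseq (unzip1 t) s
        & pairwise (fun a b => chi a.1 b.1 == a.2) t].
Proof.
elim: m => [|m [N IHm]]; first by exists 0 => X chi s _; exists [::]; rewrite sub0seq.
exists (N * #|C|).+2 => X chi [|x s] //= ; rewrite ltnS => lt_N.
have [c] := pigeonhole_count (chi x) lt_N; rewrite -size_filter => /ltnW/(IHm X chi)[t [szt sub_t hom_t]].
exists ((x, c) :: t); split; rewrite /= ?szt ?eqxx ?hom_t ?andbT //.
  exact: subseq_trans sub_t (filter_subseq _ _).
apply/allP=> y yt; have /(mem_subseq sub_t) : y.1 \in unzip1 t by apply: map_f.
by rewrite mem_filter => /andP[].
Qed.

Lemma ramsey_pairs (C : finType) (m : nat) :
  exists N, forall (X : eqType) (chi : X -> X -> C) (s : seq X), N <= size s ->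
    exists (t : seq X) (c : C),
      [/\ size t = m, subseq t s & pairwise (fun x y => chi x y == c) t].
Proof.
(* Among more than [m * #|C|] recorded colours, one occurs more than [m] times. *)
have [N homN] := ramsey_end_homogeneous C (m * #|C|).+1.
exists N => X chi s /(homN X chi)[t [szt sub_t hom_t]].
have [c] : exists c, m < count (fun a => a.2 == c) t.
  by apply: pigeonhole_count; rewrite szt.
rewrite -size_filter; set f := filter _ t => /ltnW lt_m.
have sub_t' : subseq (take m f) t.
  exact: subseq_trans (take_subseq _ _) (filter_subseq _ _).
have col a : a \in take m f -> a.2 = c.
  by move/mem_take; rewrite mem_filter => /andP[/eqP].
exists (unzip1 (take m f)), c; split.
- by rewrite size_map size_takel.
- exact: subseq_trans (map_subseq _ sub_t') sub_t.
rewrite pairwise_map; have := subseq_pairwise sub_t' hom_t.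
apply: (@sub_in_pairwise _ (mem (take m f))); last exact/allP.
by move=> a b /col <-.
Qed.

Lemma pairwise_rev (X : Type) (r : rel X) (s : seq X) :
  pairwise r (rev s) = pairwise (fun x y => r y x) s.
Proof. by elim: s => //= x s IHs; rewrite rev_cons pairwise_rcons all_rev IHs. Qed.

(** * Colourings that fail only at one arc *)

Definition del_arc (X : eqType) (r : rel X) (u v : X) : rel X :=
  [rel x y | r x y && ((x, y) != (u, v))].

(** Every clause is universal over the vertices, so all of them pass to a small configuration inside
    the digraph, where a finite search can refute them. *)
Definition near_colouring (X : eqType) (r : rel X) (u v : X) (c : X -> bool) : Prop :=
  [/\ c u = c v,
      forall z, r u z -> r z v -> c z != c u,
      forall x y, del_arc r u v x y -> del_arc r u v y x -> c x != c y
    & forall x y z, del_arc r u v x y -> del_arc r u v y z -> del_arc r u v z x ->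
        c x = c y -> c z != c x].

(** * Refutation of homogeneous configurations *)

Section Refutation.
Variables (X : eqType) (r : rel X) (u v : X).

Let r' := del_arc r u v.

Definition clash (x : X) (S : seq X) : bool :=
  has (fun y => (r' x y && r' y x) || has (fun z => [&& r' x y, r' y z & r' z x]) S) S.

(* Backtracking search over the colours of [vs]; [S] collects the vertices coloured
   like [u] and [v], and [S'] the other ones.  The nested [if]s keep the search lazy
   under a call-by-value evaluation. *)
Fixpoint uncolourable (vs S S' : seq X) : bool :=
  if vs is x :: vs then
    if (if r u x && r x v then true else
        if clash x S then true else uncolourable vs (x :: S) S')
    then (if clash x S' then true else uncolourable vs S (x :: S'))
    else false
  else false.

Variable c : X -> bool.
Hypothesis col_c : near_colouring r u v c.

Lemma clashN x S : {in S, forall y, c y = c x} -> ~~ clash x S.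
Proof.
move=> eqS; have [_ _ digon triangle] := col_c.
apply/hasPn=> y yS; rewrite negb_or; apply/andP; split.
  by apply/negP=> /andP[xy yx]; have := digon x y xy yx; rewrite (eqS y yS) eqxx.
apply/hasPn=> z zS; apply/negP=> /and3P[xy yz zx].
by have := triangle x y z xy yz zx (esym (eqS y yS)); rewrite (eqS z zS) eqxx.
Qed.

Lemma uncolourableN vs S S' :
  {in S, forall y, c y = c u} -> {in S', forall y, c y = ~~ c u} ->
  ~~ uncolourable vs S S'.
Proof.
have [_ between _ _] := col_c.
elim: vs S S' => //= x vs IHvs S S' eqS eqS'.
have [cx|cx] := eqVneq (c x) (c u).
  have /negbTE -> : ~~ clash x S by apply: clashN => y /eqS ->.
  have /negbTE -> : ~~ (r u x && r x v).
    by apply/negP=> /andP[ux xv]; have := between x ux xv; rewrite cx eqxx.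
  have /negbTE -> // : ~~ uncolourable vs (x :: S) S'.
  by apply: IHvs => // y /predU1P[->|/eqS].
have {}cx : c x = ~~ c u by move: cx; case: (c x) (c u) => [] [].
have /negbTE -> : ~~ clash x S' by apply: clashN => y /eqS' ->.
case: ifP => // _; apply: IHvs => // y /predU1P[->|/eqS'] //.
Qed.

End Refutation.

(** [f] may identify vertices, as different triangles can share their third vertex. Injectivity at
    [u] and [v] ensures that the deleted arc has no other preimage. *)
Lemma near_colouring_pullback (X T : eqType) (r : rel X) (A : rel T) (f : X -> T)
    (u v : X) (c : T -> bool) :
  (forall a b, r a b = A (f a) (f b)) ->
  (forall a, f a = f u -> a = u) -> (forall a, f a = f v -> a = v) ->
  near_colouring A (f u) (f v) c -> near_colouring r u v (c \o f).
Proof.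
move=> rE injU injV [eq_uv between digon triangle].
have delE a b : del_arc r u v a b -> del_arc A (f u) (f v) (f a) (f b).
  rewrite /del_arc /= rE => /andP[-> /=]; apply: contraNneq => -[/injU -> /injV ->].
  by rewrite eqxx.
split=> //=.
- by move=> z; rewrite !rE; apply: between.
- by move=> x y /delE xy /delE; apply: digon.
by move=> x y z /delE xy /delE yz /delE; apply: triangle.
Qed.

(* The vertex [(s, j)] is the [j]-th member of the [s]-th of three triples
   [(p, q, w)].  A pattern lists the arcs of [p w'], [q w'], [w w'], [w p'] and [w q']
   for triples [(p, q, w)] and [(p', q', w')] occurring in this order, as pairs
   (is there an arc from left to right, is there one from right to left). *)
Definition slot := ('I_3 * 'I_3)%type.
Definition code := (bool * bool)%type.
Definition pattern := (code * code * code * code * code)%type.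

(** The default value covers the pairs without a third vertex: both ends then lie in the transitive
    tournament. *)
Definition cross (tau : pattern) (j k : nat) : code :=
  let: (pw, qw, ww, wp, wq) := tau in
  match j, k with
  | 0, 2 => pw | 1, 2 => qw | 2, 2 => ww | 2, 0 => wp | 2, 1 => wq
  | _, _ => (true, false)
  end.

Definition within (j k : nat) : bool :=
  match j, k with 0, 1 | 1, 2 | 2, 0 => true | _, _ => false end.

Definition config (tau : pattern) : rel slot :=
  fun a b => if a.1 < b.1 then (cross tau a.2 b.2).1
             else if b.1 < a.1 then (cross tau b.2 a.2).2 else within a.2 b.2.

Definition ords3 : seq 'I_3 :=
  [:: @Ordinal 3 0 isT; @Ordinal 3 1 isT; @Ordinal 3 2 isT].

Definition slots : seq slot := [seq (s, j) | s <- ords3, j <- ords3].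

Lemma mem_slots a : a \in slots.
Proof. by case: a => [[[|[|[|s]]] ls] [[|[|[|j]]] lj]]. Qed.

(** In a loopless digraph, a slot adjacent to [u] cannot stand for the same vertex as [u]. This is a
    computable test for injectivity at [u]. *)
Definition separated (r : rel slot) (u : slot) : bool :=
  all (fun a => [|| a == u, r a u | r u a]) slots.

Definition refutes (r : rel slot) (uv : slot * slot) : bool :=
  let: (u, v) := uv in
  if [&& r u v, separated r u & separated r v] then
    uncolourable r u v [seq x <- slots | (x != u) && (x != v)] [:: u; v] [::]
  else false.

(* The arcs q0 p2, p0 q2, q1 w0, q0 q2, p0 p2, p0 w2, w0 p2 and w1 p1, found by a
   computer search: for every pattern, one of them cannot be critical.  The first one
   alone settles most patterns. *)
Definition test_arcs : seq (slot * slot) :=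
  let o0 := @Ordinal 3 0 isT in let o1 := @Ordinal 3 1 isT in
  let o2 := @Ordinal 3 2 isT in
  [:: ((o0, o1), (o2, o0)); ((o0, o0), (o2, o1)); ((o1, o1), (o0, o2));
      ((o0, o1), (o2, o1)); ((o0, o0), (o2, o0)); ((o0, o0), (o2, o2));
      ((o0, o2), (o2, o0)); ((o1, o2), (o1, o0))].

Definition refutable (tau : pattern) : bool := has (refutes (config tau)) test_arcs.

Definition codes : seq code := [:: (true, false); (false, true); (true, true)].

(** The pattern forced when two triangles share their third vertex; [(false, false)] is the missing
    loop there. *)
Definition equal_apex_pattern : pattern :=
  (false, true, (true, false), (false, false), (true, false), (false, true)).

Lemma refutable_codes :
  all (fun pw => all (fun qw => all (fun ww => all (fun wp => all (fun wq =>
    refutable (pw, qw, ww, wp, wq)) codes) codes) codes) codes) codes.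
Proof. by vm_compute. Qed.

Lemma refutable_equal_apex : refutable equal_apex_pattern.
Proof. by vm_compute. Qed.

(** * Critical arcs of semi-complete digraphs *)

Definition strict_arc (X : Type) (r : rel X) : rel X := [rel x y | r x y && ~~ r y x].

Section Semicomplete.
Variables (T : finType) (A : rel T).
Hypotheses (loopA : loopless A) (semiA : semicomplete A).

Lemma arc_neq x y : A x y -> x != y.
Proof. by apply: contraTneq => ->; apply: loopA. Qed.

(** In a longer cycle through [x], [y], [z], the arc between [x] and [z] either closes a triangle or
    bypasses [y]. The case [z == x] is a digon. *)
Lemma short_dicycle (S : pred T) :
  has_dicycle_in A S ->
  exists x y z, [&& S x, S y & S z] /\ [&& A x y, A y z & A z x || (z == x)].
Proof.
case=> s; have [n] := ubnP (size s); elim: n s => // n IHn [|x [|y [|z [|a s]]]] //=.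
- by move=> _ [].
- by move=> _ [_ _ _]; rewrite (negbTE (loopA x)).
- move=> _ [_ _ /and3P[Sx Sy _] /and3P[xy yx _]].
  by exists x, y, x; rewrite Sx Sy xy yx eqxx orbT.
- move=> _ [_ _ /and4P[Sx Sy Sz _] /and4P[xy yz zx _]].
  by exists x, y, z; rewrite Sx Sy Sz xy yz zx.
rewrite !ltnS => lt_n [_ /and3P[x_s y_s uniq_s] /and5P[Sx Sy Sz Sa Ss] /and4P[xy yz za pth]].
have x_neq_z : x != z by apply: contraNneq x_s => ->; rewrite !inE eqxx orbT.
have [xz|zx] := orP (semiA x_neq_z); last by exists x, y, z; rewrite Sx Sy Sz xy yz zx.
apply: (IHn [:: x, z, a & s]); rewrite //= Sx Sz Sa Ss xz za pth uniq_s.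
by move: x_s; rewrite inE negb_or => /andP[_ ->].
Qed.

Hypothesis critA : dicritical3 A.

Lemma critical_arc u v :
  A u v ->
  exists c, near_colouring A u v c /\
    (A v u \/ exists w, strict_arc A v w /\ strict_arc A w u).
Proof.
move=> uv; have [not2 crit] := critA.
set B := del_arc A u v.
have [phi phiP] : dicolourable_on [set: T] B 2.
  apply: crit; split; first by move=> x y /andP[-> _]; rewrite !inE.
  by right; exists u, v; rewrite !inE /B /del_arc /= uv eqxx.
have noC2 x y : B x y -> B y x -> phi x != phi y.
  move=> xy yx; apply/negP => /eqP eq_phi; apply: (phiP (phi x)); exists [:: x; y].
  by rewrite /= !inE eq_phi eqxx xy yx arc_neq ?(andP xy).1.
have noC3 x y z : B x y -> B y z -> B z x -> phi x = phi y -> phi z != phi x.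
  move=> xy yz zx eq_xy; apply/negP => /eqP eq_zx.
  have [/arc_neq xNy _] := andP xy; have [/arc_neq yNz _] := andP yz.
  have [/arc_neq zNx _] := andP zx.
  apply: (phiP (phi x)); exists [:: x; y; z].
  by rewrite /= !inE -eq_xy eq_zx eqxx xy yz zx negb_or xNy yNz eq_sym zNx.
have arcB x y : A x y -> B x y || ((x == u) && (y == v)).
  by move=> xy; rewrite /B /del_arc /= xy xpair_eqE orNb.
have eqB x y : A x y -> (x != u) || (y != v) -> B x y.
  by move=> xy; rewrite /B /del_arc /= xy xpair_eqE negb_and.
(* As [phi] is no colouring of [A], some digon or triangle of [A] is monochromatic, and it must use
   the arc [uv]. *)
have [phi_uv closing] : phi u = phi v /\
    (A v u \/ exists w, [/\ A v w, A w u & phi w = phi u]).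
  have [[x [y [z [/and3P[xy yz zx] /andP[/eqP eq_xy /eqP eq_xz]]]]]|none] :
      (exists x y z, [&& A x y, A y z & A z x || (z == x)] /\
                     (phi x == phi y) && (phi x == phi z)) \/
      forall x y z, [&& A x y, A y z & A z x || (z == x)] ->
                    (phi x == phi y) && (phi x == phi z) = false.
  - case: (pickP (fun a : T * T * T => let: (x, y, z) := a in
      [&& A x y, A y z & A z x || (z == x)] && ((phi x == phi y) && (phi x == phi z)))).
      by move=> [[x y] z] /andP[? ?]; left; exists x, y, z.
    by move=> none; right=> x y z xyz; have := none (x, y, z); rewrite xyz.
  - have [zx'|/eqP eq_zx] := orP zx; last first.
      subst z; have [Bxy|/andP[/eqP ? /eqP ?]] := orP (arcB _ _ xy); last by subst; split; auto.
      have [Byx|/andP[/eqP ? /eqP ?]] := orP (arcB _ _ yz); last by subst; split; auto.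
      by have := noC2 _ _ Bxy Byx; rewrite eq_xy eqxx.
    have [Bxy|/andP[/eqP ? /eqP ?]] := orP (arcB _ _ xy); last first.
      by subst; split=> //; right; exists z.
    have [Byz|/andP[/eqP ? /eqP ?]] := orP (arcB _ _ yz); last first.
      by subst; split; [rewrite -eq_xy | right; exists x].
    have [Bzx|/andP[/eqP ? /eqP ?]] := orP (arcB _ _ zx'); last first.
      by subst; split=> //; right; exists y; rewrite -eq_xy.
    by have := noC3 _ _ _ Bxy Byz Bzx eq_xy; rewrite eq_xz eqxx.
  case: not2; exists phi => k /short_dicycle[x [y [z]]].
  case=> /and3P[/andP[_ /eqP kx] /andP[_ /eqP ky] /andP[_ /eqP kz]] xyz.
  by have := none x y z xyz; rewrite kx ky kz eqxx.
have vNu : v != u by rewrite eq_sym arc_neq.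
exists (fun x => phi x == ord0); split.
  have phiE x y : ((phi x == ord0) == (phi y == ord0)) = (phi x == phi y).
    by case: (phi x) (phi y) => [[|[|?]] ?] [[|[|?]] ?].
  split; first by rewrite phi_uv.
  - move=> z uz zv; rewrite phiE; apply/negP => /eqP eq_zu.
    have [zNu zNv] : z != u /\ z != v by rewrite (arc_neq zv) eq_sym (arc_neq uz).
    have Buz : B u z by rewrite eqB ?zNv ?orbT.
    have Bzv : B z v by rewrite eqB ?zNu.
    case: closing => [vu|[w [vw wu eq_w]]].
      have Bvu : B v u by rewrite eqB ?vNu.
      by have := noC3 _ _ _ Buz Bzv Bvu; rewrite eq_zu phi_uv eqxx => /(_ erefl).
    have wNu := arc_neq wu.
    have Bvw : B v w by rewrite eqB ?vNu.
    have Bwu : B w u by rewrite eqB ?wNu.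
    have [eq_wz|wNz] := eqVneq w z.
      by subst w; have := noC2 _ _ Buz Bwu; rewrite eq_zu eqxx.
    (* Either arc closes a monochromatic triangle avoiding [uv]: [v w z] or [z w u]. *)
    have [wz|zw] := orP (semiA wNz).
      have Bwz : B w z by rewrite eqB ?wNu.
      by have := noC3 _ _ _ Bvw Bwz Bzv; rewrite eq_w eq_zu phi_uv eqxx => /(_ erefl).
    have Bzw : B z w by rewrite eqB ?zNu.
    by have := noC3 _ _ _ Bzw Bwu Buz; rewrite eq_w eq_zu eqxx => /(_ erefl).
  - by move=> x y xy yx; rewrite phiE noC2.
  move=> x y z xy yz zx eq_c; rewrite phiE; apply: noC3 xy yz zx _.
  by apply/eqP; rewrite -phiE eq_c.
case: closing => [|[w [vw wu eq_w]]]; [by left | right; exists w].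
have wNu := arc_neq wu; have vNw := arc_neq vw.
rewrite /strict_arc /= vw wu; split; apply/negP => bad.
  have := noC2 v w (eqB _ _ vw _) (eqB _ _ bad _).
  by rewrite vNu wNu eq_w phi_uv !eqxx => /(_ isT isT).
have := noC2 w u (eqB _ _ wu _) (eqB _ _ bad _).
by rewrite wNu (eq_sym w v) vNw orbT eq_w !eqxx => /(_ isT isT).
Qed.

Lemma strict_arc_triangle u v :
  strict_arc A u v -> exists w, strict_arc A v w /\ strict_arc A w u.
Proof. by case/andP=> uv /negbTE vu; have [c [_ []]] := critical_arc uv; rewrite ?vu. Qed.

(** * Triangles on a transitive tournament *)

Definition forward : rel (T * T * T) :=
  [rel X Y | let: (p, q, _) := X in let: (p', q', _) := Y in
    [&& strict_arc A p p', strict_arc A p q', strict_arc A q p' & strict_arc A q q']].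

Definition cyclic_triple : pred (T * T * T) :=
  [pred X | let: (p, q, w) := X in
    [&& strict_arc A p q, strict_arc A q w & strict_arc A w p]].

(** The last clause serves the induction: it places the first pair before all later ones. *)
Lemma transitive_triples m (s : seq T) :
  m.*2 <= size s -> pairwise (strict_arc A) s ->
  exists t, [/\ size t = m, pairwise forward t, all cyclic_triple t
    & forall p q w, (p, q, w) \in t -> p \in s /\ q \in s].
Proof.
elim: m s => [|m IHm] s; first by exists [::].
case: s => [|a [|b s]] //; rewrite doubleS !ltnS => le_ms.
rewrite /= => /and3P[/andP[ab a_s] b_s /(IHm _ le_ms)[t [szt fwd_t cyc_t mem_t]]].
have [w [bw wa]] := strict_arc_triangle ab.
exists ((a, b, w) :: t); split; rewrite /= ?szt //.
- rewrite fwd_t andbT; apply/allP=> [[[p q] w']] /mem_t[ps qs] /=.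
  by apply/and4P; split; [apply: (allP a_s) | apply: (allP a_s)
                        | apply: (allP b_s) | apply: (allP b_s)].
- by rewrite cyc_t andbT; apply/and3P.
move=> p q w'; rewrite !inE => /predU1P[[-> -> _]|/mem_t[-> ->]].
  by rewrite !eqxx orbT.
by rewrite !orbT.
Qed.

(** For the critical arc [xy], both [z] and [w] lie between [x] and [y], so they share the opposite
    colour, against the digon [zw]. *)
Lemma no_complete_four x y z w :
  ~~ pairwise [rel a b | A a b && A b a] [:: x; y; z; w].
Proof.
apply/negP; rewrite /= !andbT => /and3P[/and3P[/andP[xy yx] /andP[xz zx] /andP[xw wx]]].
move=> /andP[/andP[yz zy] /andP[yw wy]] /andP[zw wz].
have [c [[_ btw digon _] _]] := critical_arc xy.
have := digon z w; rewrite /del_arc /= zw wz !xpair_eqE !negb_and.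
rewrite (arc_neq zx) (arc_neq wx) => /(_ isT isT).
by move: (btw z xz zy) (btw w xw wy); case: (c z) (c w) (c x) => [] [] [].
Qed.

Definition arc_code (x y : T) : code := (A x y, A y x).

Lemma mem_codes x y : x != y -> arc_code x y \in codes.
Proof. by move/semiA; rewrite /arc_code; case: (A x y) (A y x) => [] []. Qed.

Definition triple_code (X Y : T * T * T) : pattern :=
  let: (p, q, w) := X in let: (p', q', w') := Y in
  (arc_code p w', arc_code q w', arc_code w w', arc_code w p', arc_code w q').

Definition member (X : T * T * T) (j : nat) : T :=
  let: (p, q, w) := X in nth p [:: p; q; w] j.

Lemma strict_arc_code x y : strict_arc A x y -> arc_code x y = (true, false).
Proof. by rewrite /arc_code; case/andP=> -> /negbTE ->. Qed.

Lemma member_within X (j k : 'I_3) :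
  cyclic_triple X -> A (member X j) (member X k) = within j k.
Proof.
case: X => [[p q] w] /and3P[/strict_arc_code[pq qp] /strict_arc_code[qw wq]].
move=> /strict_arc_code[wp pw].
by case: j k => [[|[|[|j]]] lj] [[|[|[|k]]] lk] //=; apply: negbTE.
Qed.

Lemma member_cross X Y (j k : 'I_3) :
  forward X Y -> arc_code (member X j) (member Y k) = cross (triple_code X Y) j k.
Proof.
case: X Y => [[p q] w] [[p' q'] w'] /and4P[pp' pq' qp' qq'].
case: j k => [[|[|[|j]]] lj] [[|[|[|k]]] lk] //=; exact: strict_arc_code.
Qed.

(** The strict arcs exclude every coincidence among the six vertices except [w = w'], and distinct
    vertices have a code in [codes]. *)
Lemma triple_code_refutable X Y :
  cyclic_triple X -> cyclic_triple Y -> forward X Y -> refutable (triple_code X Y).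
Proof.
case: X Y => [[p q] w] [[p' q'] w'] /and3P[_ /andP[qw wq] /andP[wp pw]].
move=> /and3P[_ /andP[qw' wq'] /andP[wp' pw']].
move=> /and4P[/andP[pp' p'p] /andP[pq' q'p] /andP[qp' p'q] /andP[qq' q'q]].
have [eq_w|neq_w] := eqVneq w w'.
  subst w'; rewrite /triple_code /arc_code qw wp qw' wp' (negbTE pw) (negbTE wq).
  by rewrite (negbTE pw') (negbTE wq') (negbTE (loopA w)) refutable_equal_apex.
have pNw' : p != w' by apply: contraNneq q'p => ->.
have qNw' : q != w' by apply: contraNneq q'q => ->.
have wNp' : w != p' by apply: contraNneq p'p => <-.
have wNq' : w != q' by apply: contraNneq q'p => <-.
move/allP: refutable_codes => /(_ _ (mem_codes pNw'))/allP/(_ _ (mem_codes qNw')).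
move=> /allP/(_ _ (mem_codes neq_w))/allP/(_ _ (mem_codes wNp')).
by move=> /allP/(_ _ (mem_codes wNq')).
Qed.

Lemma no_homogeneous_triples X0 X1 X2 tau :
  all cyclic_triple [:: X0; X1; X2] -> pairwise forward [:: X0; X1; X2] ->
  ~~ pairwise (fun X Y => triple_code X Y == tau) [:: X0; X1; X2].
Proof.
rewrite /= !andbT => /and3P[cyc0 cyc1 cyc2] /andP[/andP[fwd01 fwd02] fwd12].
apply/negP=> /andP[/andP[/eqP code01 /eqP code02] /eqP code12].
pose f (a : slot) := member (nth X0 [:: X0; X1; X2] a.1) a.2.
have cfgE a b : config tau a b = A (f a) (f b).
  have cross01 j k := member_cross j k fwd01; have cross02 j k := member_cross j k fwd02.
  have cross12 j k := member_cross j k fwd12; rewrite code01 in cross01.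
  rewrite code02 in cross02; rewrite code12 in cross12; rewrite /config /f.
  case: a b => [[[|[|[|s]]] ls] j] [[[|[|[|t]]] lt] k] //=;
  by [rewrite member_within | rewrite -cross01 | rewrite -cross02 | rewrite -cross12].
have := triple_code_refutable cyc0 cyc1 fwd01; rewrite code01.
case/hasP=> -[u v] _; rewrite /refutes; case: ifP => // /and3P[uv sepu sepv].
have inj a b : separated (config tau) b -> f a = f b -> a = b.
  move=> /allP/(_ a (mem_slots a)); rewrite !cfgE => /orP[/eqP //|] + eq_ab.
  by rewrite eq_ab orbb (negbTE (loopA _)).
rewrite cfgE in uv; have [c [col_c _]] := critical_arc uv.
have col := near_colouring_pullback cfgE (fun a => inj a u sepu) (fun a => inj a v sepv) col_c.
apply/negP; apply: (uncolourableN col) => //.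
have [eq_uv _ _ _] := col.
by move=> y; rewrite !inE => /orP[] /eqP ->.
Qed.

End Semicomplete.

(** * The bound on the order *)

Lemma dicritical_semicomplete_bounded :
  exists N, forall (T : finType) (A : rel T),
    loopless A -> semicomplete A -> dicritical3 A -> #|T| < N.
Proof.
have [M homM] := ramsey_pairs pattern 3.
(* [M] triangles use [2M] vertices; the extra 4 leave enough vertices to refute the all-digon case
   even for small [M]. *)
have [N homN] := ramsey_pairs code (M.*2 + 4).
exists N => T A loopA semiA critA; rewrite ltnNge; apply/negP.
rewrite cardE => /(homN _ (arc_code A))[s [c [szs sub_s hom_s]]].
have uniq_s : uniq s := subseq_uniq sub_s (enum_uniq _).
suff no_transitive (t : seq T) : size t = (M.*2 + 4)%N -> pairwise (strict_arc A) t -> False.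
  case: c hom_s => [[] []] hom_s.
  - case: s szs hom_s {sub_s uniq_s} => [|x [|y [|z [|w s]]]]; rewrite ?addnS // => _ hom_s.
    have sub4 : subseq [:: x; y; z; w] [:: x, y, z, w & s] := prefix_subseq _ _.
    have /negP[] := no_complete_four loopA semiA critA x y z w.
    apply: sub_pairwise (subseq_pairwise sub4 hom_s) => a b /eqP[] /=.
    by move=> -> ->.
  - apply: no_transitive szs (sub_pairwise _ hom_s) => x y /eqP[].
    by rewrite /strict_arc /= => -> ->.
  - apply: (no_transitive (rev s)); first by rewrite size_rev.
    rewrite pairwise_rev; apply: sub_pairwise hom_s => x y /eqP[].
    by rewrite /strict_arc /= => -> ->.
  - case: s szs hom_s uniq_s {sub_s} => [|x [|y s]]; rewrite ?addnS // => _ /=.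
    move=> /and3P[/andP[/eqP[xy yx] _] _ _] /andP[]; rewrite inE negb_or.
    by case/andP=> /semiA; rewrite xy yx.
move=> szt tr_t.
have [|u [szu fwd_u cyc_u _]] := transitive_triples loopA semiA critA (m := M) _ tr_t.
  by rewrite szt leq_addr.
have [|v [tau [szv sub_v hom_v]]] := homM _ (triple_code A) u; first by rewrite szu.
case: v szv sub_v hom_v => [|X0 [|X1 [|X2 [|]]]] // _ sub_v; apply/negP.
apply: (no_homogeneous_triples loopA semiA critA).
  by apply/allP=> X /(mem_subseq sub_v); apply: (allP cyc_u).
exact: subseq_pairwise sub_v fwd_u.
Qed.

(* There is a finite family D_0, ..., D_{k-1} of digraphs such that every
   3-dicritical semi-complete digraph is isomorphic to one of them. *)
Theorem theorem9 :
  exists (k : nat) (D : 'I_k -> {n : nat & rel 'I_n}),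
    forall (T : finType) (A : rel T),
      loopless A -> semicomplete A -> dicritical3 A ->
      exists i : 'I_k, diso A (projT2 (D i)).
Proof.
have [N boundN] := dicritical_semicomplete_bounded.
(* Arc tables of all digraphs of order below [N] form a finite type, whose enumeration gives the
   family. *)
pose F : finType := {n : 'I_N & {ffun 'I_n * 'I_n -> bool}}.
pose D (i : 'I_#|F|) : {n : nat & rel 'I_n} :=
  let: existT n g := enum_val i in existT _ (n : nat) (fun x y => g (x, y)).
exists #|F|, D => T A loopA semiA critA.
pose n : 'I_N := Ordinal (boundN T A loopA semiA critA).
pose g : {ffun 'I_n * 'I_n -> bool} := [ffun a => A (enum_val a.1) (enum_val a.2)].
exists (enum_rank (existT _ n g : F)); rewrite /D enum_rankK /=.
exists enum_rank; split; first exact: enum_rank_bij.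
by move=> x y; rewrite ffunE /= !enum_rankK.
Qed.
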